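(* Let $n$ and $r$ be integers with $1\le r\le n$, let $P_n=\left(\binom{i-1}{j-1}\right)_{1\le i,j\le n}$ be the $n\times n$ lower triangular Pascal matrix, and let $I_n$ be the identity matrix. Then the integer matrix $(P_n-I_n)^r$ is equivalent to the $n\times n$ diagonal matrix $$\mathrm{diag}\big(1^{\overline{r}},2^{\overline{r}},\ldots,(n-r)^{\overline{r}},0,\ldots,0\big),$$ whose last $r$ diagonal entries are $0$.
   Context: $i^{\overline{r}}=i(i+1)\cdots(i+r-1)$ is the rising factorial. Two $n\times n$ integer matrices $A,B$ are equivalent if there exist unimodular matrices $U,V$ (integer $n\times n$ matrices with determinant $\pm1$) such that $UAV=B$. A binomial coefficient $\binom{a}{b}$ with $0\le a<b$ is zero. *)

(* Defs.v *)
From mathcomp Require Import all_boot all_order all_algebra.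

Set Implicit Arguments.
Unset Strict Implicit.
Unset Printing Implicit Defensive.

Import GRing.Theory.
Local Open Scope ring_scope.

Definition rising_factorial (i r : nat) : nat := (\prod_(k < r) (i + k))%N.

Definition unimodular (n : nat) (U : 'M[int]_n) : Prop :=
  \det U = 1 \/ \det U = -1.

Definition equivalent_mx (n : nat) (A B : 'M[int]_n) : Prop :=
  exists U V : 'M[int]_n,
    [/\ unimodular U, unimodular V & U *m A *m V = B].

(* Ordinal indices start at 0, so the entry binom(i-1, j-1) for 1 <= i, j <= n
   reads 'C(i, j) for i, j : 'I_n. *)
Definition pascal_mx (n : nat) : 'M[int]_n :=
  \matrix_(i < n, j < n) ('C(i, j))%:Z.

Definition rising_diag_mx (n r : nat) : 'M[int]_n :=
  diag_mx (\row_(i < n)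
    if (i < n - r)%N then (rising_factorial i.+1 r)%:Z else 0).

(* Main.v *)
Require Import Defs.
From mathcomp Require Import all_boot all_order all_algebra.
From mathcomp Require Import fingroup perm.
Local Open Scope ring_scope.

(** Reading row vectors as polynomials of degree < n, right multiplication by
    the Pascal matrix is p(X) |-> p(X + 1), so [pascal_mx n - 1%:M] is the
    forward difference operator in the monomial basis.  The falling factorials
    X(X-1)...(X-i+1) form another Z-basis, related to the monomials by a
    unitriangular matrix, and the r-th difference sends the i-th of them to
    i(i-1)...(i-r+1) times the (i-r)-th.  In that basis the matrix is
    therefore diagonal up to a cyclic shift of its rows. *)

Import GRing.Theory.

Definition falling_poly (i : nat) : {poly int} := \prod_(k < i) ('X - (k%:R)%:P).

Lemma falling_polyS i :
  falling_poly i.+1 = falling_poly i * ('X - (i%:R)%:P).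
Proof. by rewrite /falling_poly big_ord_recr. Qed.

Lemma size_falling_poly i : size (falling_poly i) = i.+1.
Proof. by rewrite /falling_poly size_prod_XsubC /index_enum -enumT size_enum_ord. Qed.

Lemma monic_falling_poly i : falling_poly i \is monic.
Proof. by apply: monic_prod => k _; exact: monicXsubC. Qed.

(** Substituting ['X + 1] turns the factors X, X-1, ..., X-i into X+1, X, ..., X-i+1. *)
Lemma falling_poly_shiftS i :
  falling_poly i.+1 \Po ('X + 1) = falling_poly i * ('X + 1).
Proof.
elim: i => [|i IHi].
  by rewrite /falling_poly !big_ord_recl !big_ord0 /= subr0 mulr1 mul1r comp_polyX.
rewrite falling_polyS comp_polyM IHi comp_polyB comp_polyX comp_polyC.
rewrite falling_polyS -natr1 polyCD -!mulrA [('X + 1) * _]mulrC.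
by rewrite opprD addrACA subrr addr0.
Qed.

(** For i > 0 both terms share the factor [falling_poly i.-1], and the cofactors differ by (X+1) -
    (X-(i-1)) = i. For i = 0 the multiplicity 0 makes the truncated [i.-1] harmless. *)
Lemma falling_poly_diff i :
  falling_poly i \Po ('X + 1) - falling_poly i = falling_poly i.-1 *+ i.
Proof.
case: i => [|i]; first by rewrite /falling_poly big_ord0 -polyC1 comp_polyC subrr.
rewrite falling_poly_shiftS falling_polyS -mulrBr opprB addrC addrA addrNK /=.
by rewrite -polyC1 -polyCD natr1 polyC_natr mulr_natr.
Qed.

(** By linearity this is the binomial theorem for each (X+1)^i with i < n. *)
Lemma rVpoly_pascal n (v : 'rV[int]_n) :
  rVpoly (v *m pascal_mx n) = rVpoly v \Po ('X + 1).
Proof.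
have rVpolyE (w : 'rV[int]_n) : rVpoly w = \sum_(i < n) w 0 i *: 'X^i.
  rewrite /rVpoly poly_def; apply: eq_bigr => i _.
  by rewrite insubT //= => lt_in; congr (w 0 _ *: _); apply: val_inj.
rewrite !rVpolyE raddf_sum /=.
under eq_bigr => j _ do rewrite mxE scaler_suml.
rewrite exchange_big /=; apply: eq_bigr => i _.
rewrite comp_polyZ comp_Xn_poly addrC exprDn.
under eq_bigr => j _ do rewrite mxE -scalerA.
rewrite -scaler_sumr; congr (_ *: _).
under [RHS]eq_bigr => j _ do rewrite expr1n mul1r.
rewrite -(big_mkord xpredT (fun j => 'X^j *+ 'C(i, j))).
rewrite -(big_mkord xpredT (fun j => ('C(i, j))%:Z *: 'X^j)).
(* The row of the matrix has n entries, the binomial expansion only i+1 terms; the surplus binomials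
   vanish. *)
rewrite [LHS](big_cat_nat (n := i.+1)) //= [X in _ + X]big_nat_cond [X in _ + X]big1.
  by rewrite addr0; apply: eq_bigr => j _; rewrite -scaler_nat natz.
by move=> j /andP[/andP[lt_ij _] _]; rewrite bin_small ?scale0r.
Qed.

Definition falling_mx n : 'M[int]_n :=
  \matrix_(i < n) poly_rV (falling_poly i).

Lemma rVpoly_row_falling n (i : 'I_n) :
  rVpoly (row i (falling_mx n)) = falling_poly i.
Proof. by rewrite rowK poly_rV_K // size_falling_poly. Qed.

Lemma det_falling_mx n : \det (falling_mx n) = 1.
Proof.
rewrite det_trig => [|]; last first.
  apply/is_trig_mxP => i j lt_ij.
  by rewrite !mxE nth_default // size_falling_poly.
apply: big1 => i _; rewrite !mxE.
by have /monicP := monic_falling_poly i; rewrite lead_coefE size_falling_poly.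
Qed.

(** The r-th difference in the falling factorial basis. Writing [j + r == i] instead of j = i-r
    avoids truncated subtraction. *)
Definition falling_diff_mx n r : 'M[int]_n :=
  \matrix_(i < n, j < n) ((i ^_ r)%:R *+ (j + r == i)%N).

Lemma falling_mx_pascal n :
  falling_mx n *m (pascal_mx n - 1%:M) = falling_diff_mx n 1 *m falling_mx n.
Proof.
apply/row_matrixP => i; apply: (can_inj rVpolyK).
rewrite !row_mul mulmxBr mulmx1 linearB /= rVpoly_pascal rVpoly_row_falling.
rewrite falling_poly_diff mulmx_sum_row linear_sum /=.
case: i => [[|i] lt_in] /=.
  rewrite mulr0n big1 // => j _.
  by rewrite !mxE addn1 mulr0n scale0r linear0.
rewrite (bigD1 (Ordinal (ltnW lt_in))) //= big1 ?addr0 => [|j].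
  by rewrite !mxE addn1 eqxx ffactn1 linearZ /= rVpoly_row_falling scaler_nat.
rewrite -val_eqE /= => neq_ji.
by rewrite !mxE addn1 eqSS (negbTE neq_ji) scale0r linear0.
Qed.

(** Row i of the first factor has at most one nonzero entry, i in column i-1, and i times the r-th
    falling factorial of i-1 is the (r+1)-st of i. *)
Lemma falling_diff_mxS n r :
  falling_diff_mx n r.+1 = falling_diff_mx n 1 *m falling_diff_mx n r.
Proof.
apply/matrixP => i j; rewrite !mxE.
case: i => [[|i] lt_in] /=.
  by rewrite addnS big1 // => k _; rewrite !mxE addn1 mul0r.
rewrite (bigD1 (Ordinal (ltnW lt_in))) //= big1 ?addr0 => [|k].
  rewrite !mxE addn1 eqxx addnS eqSS ffactn1 ffactSS /=.
  by rewrite natrM mulr1n -mulrnAr.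
rewrite -val_eqE /= => neq_ki.
by rewrite !mxE addn1 eqSS (negbTE neq_ki) mul0r.
Qed.

Lemma falling_mx_pascalX n r :
  falling_mx n *m (pascal_mx n - 1%:M) ^+ r =
  falling_diff_mx n r *m falling_mx n.
Proof.
elim: r => [|r IHr].
  rewrite expr0 mulmx1 -[LHS]mul1mx; congr (_ *m _).
  by apply/matrixP => i j; rewrite !mxE ffactn0 addn0 eq_sym.
rewrite exprS falling_diff_mxS mulmxA falling_mx_pascal -!mulmxA.
by rewrite IHr.
Qed.

Lemma rising_factorialE i r : rising_factorial i.+1 r = ((i + r) ^_ r)%N.
Proof.
elim: r => [|r IHr]; first by rewrite /rising_factorial big_ord0.
by rewrite /rising_factorial big_ord_recr /= -/(rising_factorial _ _) IHr
  addnS ffactSS mulnC.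
Qed.

Lemma row_perm_falling_diff_mx n r : (r <= n)%N ->
  exists s : 'S_n, row_perm s (falling_diff_mx n r) = rising_diag_mx n r.
Proof.
case: n => [|n] le_rn; first by exists 1%g; apply/matrixP => -[].
(* The shift i -> i+r modulo the size, which must be positive for ['I_n.+1] to carry this
   addition. *)
exists (perm (addIr (inZp r : 'I_n.+1))); apply/matrixP => i j.
rewrite !mxE permE /= modnDmr rising_factorialE.
have [lt_i|le_i] := ltnP i (n.+1 - r)%N.
  rewrite modn_small ?eqn_add2r; last by rewrite addnC -ltn_subRL.
  by rewrite eq_sym natz.
(* The last r rows wrap around to an index below r, whose r-th falling factorial is 0. *)
rewrite leq_subLR addnC in le_i.
have lt_ir : (i + r - n.+1 < r)%N.
  by rewrite ltn_subLR // ltn_add2r.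
rewrite -(subnK le_i) modnDr modn_small ?(leq_trans lt_ir) //.
by rewrite ffact_small // mulr0n !mul0rn.
Qed.

Theorem theorem3 (n r : nat) (hr : (1 <= r <= n)%N) :
  equivalent_mx ((pascal_mx n - 1%:M) ^+ r) (rising_diag_mx n r).
Proof.
have /andP[_ /row_perm_falling_diff_mx[s <-]] := hr.
have F_unit : falling_mx n \in unitmx by rewrite unitmxE det_falling_mx unitr1.
(* Conjugation by [falling_mx n] gives [falling_diff_mx n r]; the permutation then moves its entries
   onto the diagonal. *)
exists (perm_mx s *m falling_mx n), (invmx (falling_mx n)); split.
- rewrite /unimodular det_mulmx det_perm det_falling_mx mulr1.
  by case: (odd_perm s); [right | left].
- by left; rewrite det_inv det_falling_mx invr1.
- by rewrite -(mulmxA (perm_mx s)) falling_mx_pascalX mulmxA mulmxK // row_permE.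
Qed.
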